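(* For all symmetric sequences $\mathcal V,\mathcal W,\mathcal Y,\mathcal Z$ of simplicial sets, there is a morphism of symmetric sequences $$\sigma:(\mathcal V\circ\mathcal W)\,\square\,(\mathcal Y\circ\mathcal Z)\to(\mathcal V\square\mathcal Y)\circ(\mathcal W\square\mathcal Z),$$ natural in $\mathcal V,\mathcal W,\mathcal Y,\mathcal Z$, such that for all symmetric sequences $\mathcal U,\mathcal V,\mathcal W,\mathcal X,\mathcal Y,\mathcal Z$ the two composites $$(\mathcal U\circ\mathcal V\circ\mathcal W)\square(\mathcal X\circ\mathcal Y\circ\mathcal Z)\xrightarrow{\ \sigma\ }(\mathcal U\square\mathcal X)\circ\big((\mathcal V\circ\mathcal W)\square(\mathcal Y\circ\mathcal Z)\big)\xrightarrow{\ \mathrm{Id}\circ\sigma\ }(\mathcal U\square\mathcal X)\circ(\mathcal V\square\mathcal Y)\circ(\mathcal W\square\mathcal Z)$$ and $$(\mathcal U\circ\mathcal V\circ\mathcal W)\square(\mathcal X\circ\mathcal Y\circ\mathcal Z)\xrightarrow{\ \sigma\ }\big((\mathcal U\circ\mathcal V)\square(\mathcal X\circ\mathcal Y)\big)\circ(\mathcal W\square\mathcal Z)\xrightarrow{\ \sigma\circ\mathrm{Id}\ }(\mathcal U\square\mathcal X)\circ(\mathcal V\square\mathcal Y)\circ(\mathcal W\square\mathcal Z)$$ are equal.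
   Context: A symmetric sequence is a family $\mathcal X=(\mathcal X(n))_{n\ge0}$ of simplicial sets with right $\mathfrak S_n$-actions. The composition product is the standard one: $(\mathcal X\circ\mathcal Y)(n)=\coprod_k\mathcal X(k)\times_{\mathfrak S_k}\coprod_{n_1+\cdots+n_k=n}(\mathcal Y(n_1)\times\cdots\times\mathcal Y(n_k))\times_{\mathfrak S_{n_1}\times\cdots\times\mathfrak S_{n_k}}\mathfrak S_n$ (associative up to canonical isomorphism, which is suppressed). The matrix monoidal product is $(\mathcal X\square\mathcal Y)(n)=\coprod_{lm=n}(\mathcal X(l)\times\mathcal Y(m))\times_{\mathfrak S_l\times\mathfrak S_m}\mathfrak S_n$, where $\mathfrak S_l\times\mathfrak S_m$ acts on $\mathfrak S_{lm}$ through $\nu_{l,m}(\sigma,\tau)(i,j)=(\sigma(i),\tau(j))$, identifying $(i,j)\in\{1,\dots,l\}\times\{1,\dots,m\}$ with $(i-1)m+j$. *)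

(* Defs.v *)
From HB Require Import structures.
From Stdlib Require Import Relations.Relation_Operators.
From mathcomp Require Import all_boot all_order all_fingroup.
From mathcomp Require Import generic_quotient boolp.

Set Implicit Arguments.
Unset Strict Implicit.
Unset Printing Implicit Defensive.

Local Open Scope quotient_scope.

Section Quotient.
Variables (T : Type) (R : T -> T -> Prop).

Definition gen_eq : rel {classic T} := fun x y => `[< clos_refl_sym_trans T R x y >].

Lemma gen_eq_refl : reflexive gen_eq.
Proof. by move=> x; apply/asboolP; apply: rst_refl. Qed.

Lemma gen_eq_sym : symmetric gen_eq.
Proof. by move=> x y; apply/asboolP/asboolP; apply: rst_sym. Qed.

Lemma gen_eq_trans : transitive gen_eq.
Proof. by move=> y x z /asboolP xy /asboolP yz; apply/asboolP; apply: rst_trans yz. Qed.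

Canonical gen_eq_equiv := EquivRel gen_eq gen_eq_refl gen_eq_sym gen_eq_trans.

Definition quot : Type := {eq_quot gen_eq_equiv}.
Definition cls (x : T) : quot := \pi_{eq_quot gen_eq_equiv}%qT (x : {classic T}).
Definition rep (u : quot) : T := repr (u : {eq_quot gen_eq_equiv}).

Lemma repK u : cls (rep u) = u.
Proof. exact: reprK. Qed.

Lemma cls_eq x y : R x y -> cls x = cls y.
Proof. by move=> Rxy; apply/eqmodP; apply/asboolP; apply: rst_step. Qed.

Lemma cls_inv (S : Type) (f : T -> S) :
  (forall x y, R x y -> f x = f y) -> forall x, f (rep (cls x)) = f x.
Proof.
move=> fR x.
have fR' y z : clos_refl_sym_trans T R y z -> f y = f z.
  by elim=> // y1 t z1 _ -> _ ->.
apply: fR'; apply/asboolP; apply/(@eqmodP _ gen_eq_equiv); exact: repK (cls x).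
Qed.

End Quotient.

(** The balanced product [A x_G B]: the quotient of [A * B] by the equivalence relation
    generated by [(a g, b) ~ (a, g b)]. *)
Section Balanced.
Variables (A B G : Type) (ra : A -> G -> A) (la : G -> B -> B).

Inductive balance : A * B -> A * B -> Prop :=
  Balance a g b : balance (ra a g, b) (a, la g b).

Definition balanced : Type := quot balance.

End Balanced.

(* The product of 𝔖_n: MathComp's [s * t] is "s, then t". *)
Definition pcomp n (s t : 'S_n) : 'S_n := (t * s)%g.

Lemma pcompE n (s t : 'S_n) i : pcomp s t i = s (t i).
Proof. exact: permM. Qed.

Lemma pcompA n (s t u : 'S_n) : pcomp s (pcomp t u) = pcomp (pcomp s t) u.
Proof. by rewrite /pcomp mulgA. Qed.

Lemma pcomp1 n (s : 'S_n) : pcomp s 1%g = s.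
Proof. exact: mul1g. Qed.

Record partn (k n : nat) := Partn
  { part :> 'I_k -> nat; partE : \sum_(i < k) part i = n }.

Section Blocks.
Variables (k n : nat).
Implicit Types (p : partn k n).

(* [pos p] identifies the disjoint union of the blocks with [{0, ..., n-1}],
   lexicographically. *)
Definition pos p (x : {i : 'I_k & 'I_(p i)}) : 'I_n :=
  cast_ord (partE p) (tagnat.rank x).

Definition coord p (r : 'I_n) : {i : 'I_k & 'I_(p i)} :=
  tagnat.sig (cast_ord (esym (partE p)) r).

Lemma posK p : cancel (@pos p) (coord p).
Proof. by move=> x; rewrite /coord /pos cast_ordK tagnat.rankK. Qed.

Lemma coordK p : cancel (coord p) (@pos p).
Proof. by move=> x; rewrite /coord /pos tagnat.sigK cast_ordKV. Qed.

(* The block sum, i.e. the inclusion of the product of the [𝔖_(p i)] in [𝔖_n]. *)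
Definition bsum_fun p (t : forall i, 'S_(p i)) (r : 'I_n) : 'I_n :=
  let x := coord p r in
  pos (Tagged (fun i => 'I_(p i)) (t (tag x) (tagged x))).

Lemma bsum_inj p (t : forall i, 'S_(p i)) : injective (bsum_fun t).
Proof.
apply: (can_inj (g := bsum_fun (fun i => (t i)^-1%g))) => r.
by rewrite /bsum_fun posK /= permK -[RHS](coordK p) /=; case: (coord p r).
Qed.

Definition bsum p (t : forall i, 'S_(p i)) : 'S_n := perm (@bsum_inj p t).

Lemma partn_actP p (s : 'S_k) : \sum_(i < k) p (s^-1%g i) = n.
Proof.
rewrite -[RHS](partE p) [RHS](reindex_inj (@perm_inj _ s^-1%g)) /=.
exact: eq_bigr.
Qed.

(* The left action of [𝔖_k] on partitions: the [i]-th block becomes the [s i]-th. *)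
Definition partn_act (s : 'S_k) p : partn k n := Partn (partn_actP p s).

(* [block_perm s p] sends the [j]-th element of the [i]-th block of [p] to the [j]-th
   element of the [s i]-th block of [partn_act s p].  Its inverse, [block_inv], is the
   easier one to write. *)
Definition block_inv (s : 'S_k) p (r : 'I_n) : 'I_n :=
  let x := coord (partn_act s p) r in
  pos (Tagged (fun i => 'I_(p i)) (tagged x : 'I_(p (s^-1%g (tag x))))).

Lemma block_inv_inj s p : injective (block_inv s p).
Proof.
move=> r r' E; apply: (can_inj (coordK (partn_act s p))).
case: (coord _ r) (coord _ r') (can_inj (@posK p) E) => [i j] [i' j'] {}E.
have /perm_inj Ei : s^-1%g i = s^-1%g i' := congr1 tag E.
by case: _ / Ei in j' E *; have /= -> := eq_from_Tagged E.
Qed.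

Definition block_perm (s : 'S_k) p : 'S_n := ((perm (@block_inv_inj s p))^-1)%g.

Lemma block_permV s p x :
  (block_perm s p)^-1%g (@pos (partn_act s p) x) =
  pos (Tagged (fun i => 'I_(p i)) (tagged x : 'I_(p (s^-1%g (tag x))))).
Proof. by rewrite /block_perm invgK permE /block_inv posK. Qed.

Lemma bsumE p (t : forall i, 'S_(p i)) x :
  bsum t (pos x) = pos (Tagged (fun i => 'I_(p i)) (t (tag x) (tagged x))).
Proof. by rewrite permE /bsum_fun posK. Qed.

Lemma bsumV p (t : forall i, 'S_(p i)) x :
  (bsum t)^-1%g (pos x) =
  pos (Tagged (fun i => 'I_(p i)) ((t (tag x))^-1%g (tagged x))).
Proof. by apply: (@perm_inj _ (bsum t)); rewrite permKV bsumE /= permKV; case: x. Qed.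

Lemma block_bsum s p (t : forall i, 'S_(p i)) :
  pcomp (block_perm s p) (bsum t) =
  pcomp (@bsum (partn_act s p) (fun i => t (s^-1%g i))) (block_perm s p).
Proof.
rewrite /pcomp; apply: invg_inj; rewrite !invMg; apply/permP => r.
rewrite -(coordK (partn_act s p) r) !permM block_permV.
by rewrite (@bsumV (partn_act s p)) bsumV block_permV.
Qed.

End Blocks.

Record factn (n : nat) := Factn { frow : nat; fcol : nat; factE : frow * fcol = n }.

Section Matrix.
Variable n : nat.
Implicit Types (q : factn n).

Lemma mpos_subproof q (i : 'I_(frow q)) (j : 'I_(fcol q)) : i * fcol q + j < n.
Proof.
rewrite -[ltnRHS](factE q); apply: (@leq_trans (i.+1 * fcol q)).
  by rewrite mulSn addnC ltn_add2r.
by rewrite leq_mul2r ltn_ord orbT.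
Qed.

(* With indices starting from 0, (i,j) is identified with [i * m + j]. *)
Definition mpos q (x : 'I_(frow q) * 'I_(fcol q)) : 'I_n :=
  Ordinal (mpos_subproof x.1 x.2).

Lemma fcol_gt0 q (r : 'I_n) : 0 < fcol q.
Proof. by case: (fcol q) (factE q) r => // <-; rewrite muln0 => -[]. Qed.

Lemma mcoord_row q (r : 'I_n) : r %/ fcol q < frow q.
Proof. by rewrite ltn_divLR ?(fcol_gt0 q r) // factE. Qed.

Lemma mcoord_col q (r : 'I_n) : r %% fcol q < fcol q.
Proof. by rewrite ltn_mod (fcol_gt0 q r). Qed.

Definition mcoord q (r : 'I_n) : 'I_(frow q) * 'I_(fcol q) :=
  (Ordinal (mcoord_row q r), Ordinal (mcoord_col q r)).

Lemma mcoordK q : cancel (mcoord q) (@mpos q).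
Proof. by move=> r; apply: val_inj; rewrite /= -divn_eq. Qed.

Lemma mposK q : cancel (@mpos q) (mcoord q).
Proof.
move=> [i j]; have q0 : 0 < fcol q by apply: leq_ltn_trans (ltn_ord j).
congr pair; apply: val_inj => /=.
  by rewrite divnMDl // divn_small ?addn0.
by rewrite modnMDl modn_small.
Qed.

Definition nu_fun q (st : 'S_(frow q) * 'S_(fcol q)) (r : 'I_n) : 'I_n :=
  mpos (st.1 (mcoord q r).1, st.2 (mcoord q r).2).

Lemma nu_inj q st : injective (@nu_fun q st).
Proof.
apply: (can_inj (g := @nu_fun q (st.1^-1%g, st.2^-1%g))) => r.
by rewrite /nu_fun !mposK !permK -surjective_pairing mcoordK.
Qed.

Definition nu q (st : 'S_(frow q) * 'S_(fcol q)) : 'S_n := perm (@nu_inj q st).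

Lemma nuE q st x : @nu q st (mpos x) = mpos (st.1 x.1, st.2 x.2).
Proof. by rewrite permE /nu_fun mposK. Qed.

End Matrix.

Record sSet := SSet {
  simp :> nat -> Type;
  sop : forall d e, {omorphism 'I_d.+1 -> 'I_e.+1} -> simp e -> simp d;
  sop_id : forall d (x : simp d), sop idfun x = x;
  sop_comp : forall d e f (g : {omorphism 'I_e.+1 -> 'I_f.+1})
      (h : {omorphism 'I_d.+1 -> 'I_e.+1}) (x : simp f),
    sop (g \o h) x = sop h (sop g x) }.

Record symSeq := SymSeq {
  obj :> nat -> sSet;
  ract : forall n d, obj n d -> 'S_n -> obj n d;
  ract1 : forall n d (x : obj n d), ract x 1%g = x;
  ract_comp : forall n d (x : obj n d) (s t : 'S_n),
    ract x (pcomp s t) = ract (ract x s) t;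
  ract_sop : forall n d e (h : {omorphism 'I_d.+1 -> 'I_e.+1}) (x : obj n e) (s : 'S_n),
    sop h (ract x s) = ract (sop h x) s }.

Record symHom (X Y : symSeq) := SymHom {
  hom :> forall n d, X n d -> Y n d;
  hom_sop : forall n d e (h : {omorphism 'I_d.+1 -> 'I_e.+1}) (x : X n e),
    hom (sop h x) = sop h (hom x);
  hom_act : forall n d (x : X n d) (s : 'S_n), hom (ract x s) = ract (hom x) s }.

Definition hom_id (X : symSeq) : symHom X X :=
  @SymHom X X (fun n d => idfun) (fun _ _ _ _ _ => erefl) (fun _ _ _ _ => erefl).

Lemma hom_comp_sop X Y Z (g : symHom Y Z) (f : symHom X Y) n d e
    (h : {omorphism 'I_d.+1 -> 'I_e.+1}) (x : X n e) :
  g n d (f n d (sop h x)) = sop h (g n e (f n e x)).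
Proof. by rewrite !hom_sop. Qed.

Lemma hom_comp_act X Y Z (g : symHom Y Z) (f : symHom X Y) n d (x : X n d) (s : 'S_n) :
  g n d (f n d (ract x s)) = ract (g n d (f n d x)) s.
Proof. by rewrite !hom_act. Qed.

Definition hom_comp X Y Z (g : symHom Y Z) (f : symHom X Y) : symHom X Z :=
  SymHom (hom_comp_sop g f) (hom_comp_act g f).

Definition eq_hom X Y (f g : symHom X Y) : Prop :=
  forall n d (x : X n d), f n d x = g n d x.

Section CompSimp.
Variables X Y : symSeq.

Definition fam_act k n (p : partn k n) d (y : forall i, Y (p i) d)
    (t : forall i, 'S_(p i)) : forall i, Y (p i) d := fun i => ract (y i) (t i).

(* The coproduct over [n_1 + ... + n_k = n] of the
   [(Y(n_1) * ... * Y(n_k)) x_(𝔖_(n_1) * ... * 𝔖_(n_k)) 𝔖_n], in degree [d]. *)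
Definition arr k n d : Type :=
  {p : partn k n &
    balanced (@fam_act k n p d) (fun t (r : 'S_n) => pcomp (bsum t) r)}.

Definition arr_mk k n d (p : partn k n) (y : forall i, Y (p i) d) (r : 'S_n) :
  arr k n d := existT _ p (cls _ (y, r)).

(* The left action of [𝔖_k], permuting the blocks. *)
Definition arr_act k n d (s : 'S_k) (u : arr k n d) : arr k n d :=
  let (p, c) := u in let (y, r) := rep c in
  @arr_mk k n d (partn_act s p) (fun i => y (s^-1%g i)) (pcomp (block_perm s p) r).

Definition circ_simp n d : Type :=
  {k : nat & balanced (@ract X k d) (@arr_act k n d)}.

Definition circ_mk n d k (x : X k d) (p : partn k n) (y : forall i, Y (p i) d)
  (r : 'S_n) : circ_simp n d := existT _ k (cls _ (x, arr_mk y r)).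

Lemma arr_glue k n d (p : partn k n) (y : forall i, Y (p i) d) t r :
  arr_mk (fam_act y t) r = arr_mk y (pcomp (bsum t) r).
Proof. by congr existT; apply: cls_eq. Qed.

Lemma arr_ind k n d (P : arr k n d -> Prop) :
  (forall p y r, P (@arr_mk k n d p y r)) -> forall u, P u.
Proof. by move=> IH [p c]; rewrite -[c]repK; case: (rep c) => y r; apply: IH. Qed.

Lemma arr_actE k n d s (p : partn k n) (y : forall i, Y (p i) d) r :
  arr_act s (arr_mk y r) =
  @arr_mk k n d (partn_act s p) (fun i => y (s^-1%g i)) (pcomp (block_perm s p) r).
Proof.
rewrite /arr_act /arr_mk.
pose f (z : (forall i, Y (p i) d) * 'S_n) := @arr_mk k n d (partn_act s p)
  (fun i => z.1 (s^-1%g i)) (pcomp (block_perm s p) z.2).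
suff: f (rep (cls (balance (@fam_act k n p d)
    (fun t (r : 'S_n) => pcomp (bsum t) r)) (y, r))) = f (y, r).
  by rewrite /f; case: (rep _).
apply: cls_inv => _ _ [{}y t {}r]; rewrite /f /=.
rewrite pcompA block_bsum -pcompA -arr_glue //.
Qed.

Lemma circ_glue_bsum n d k (x : X k d) (p : partn k n) (y : forall i, Y (p i) d) t r :
  circ_mk x (fam_act y t) r = circ_mk x y (pcomp (bsum t) r).
Proof. by rewrite /circ_mk arr_glue. Qed.

Lemma circ_glue_block n d k (x : X k d) (s : 'S_k) (p : partn k n)
    (y : forall i, Y (p i) d) r :
  circ_mk (ract x s) y r =
  @circ_mk n d k x (partn_act s p) (fun i => y (s^-1%g i)) (pcomp (block_perm s p) r).
Proof. by congr existT; rewrite -arr_actE; apply: cls_eq. Qed.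

Lemma circ_ind n d (P : circ_simp n d -> Prop) :
  (forall k x p y r, P (@circ_mk n d k x p y r)) -> forall u, P u.
Proof.
move=> IH [k c]; rewrite -[c]repK; case: (rep c) => x u.
by elim/arr_ind: u => p y r; apply: IH.
Qed.

(* [circ_rec f] is the map out of the composition product induced by a map [f] on
   representatives; by [circ_recE] it is computed by [f] as soon as [f] is invariant. *)
Definition circ_rec n d (T : Type)
    (f : forall k (x : X k d) (p : partn k n) (y : forall i, Y (p i) d) (r : 'S_n), T)
    (u : circ_simp n d) : T :=
  let (k, c) := u in let (x, v) := rep c in
  let (p, e) := v in let (y, r) := rep e in f k x p y r.

Definition circ_inv n d (T : Type)
    (f : forall k (x : X k d) (p : partn k n) (y : forall i, Y (p i) d) (r : 'S_n), T) :=
  (forall k x p y t r, f k x p (fam_act y t) r = f k x p y (pcomp (bsum t) r)) /\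
  (forall k x s p y r, f k (ract x s) p y r =
     f k x (partn_act s p) (fun i => y (s^-1%g i)) (pcomp (block_perm s p) r)).

Lemma circ_recE n d (T : Type) f : @circ_inv n d T f ->
  forall k x p y r, circ_rec f (@circ_mk n d k x p y r) = f k x p y r.
Proof.
move=> [f_bsum f_block] k x p y r; rewrite /circ_rec /circ_mk.
pose g (x : X k d) (v : arr k n d) : T :=
  let (p, e) := v in let (y, r) := rep e in f k x p y r.
have gE x1 p1 y1 r1 : g x1 (@arr_mk k n d p1 y1 r1) = f k x1 p1 y1 r1.
  rewrite /g /arr_mk; pose h (z : (forall i, Y (p1 i) d) * 'S_n) := f k x1 p1 z.1 z.2.
  rewrite -[RHS]/(h (y1, r1)) -[RHS](cls_inv (R := balance (@fam_act k n p1 d)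
    (fun t (r : 'S_n) => pcomp (bsum t) r))); first by rewrite /h; case: (rep _).
  by move=> _ _ [y2 t r2]; rewrite /h /= f_bsum.
rewrite -gE.
have := @cls_inv _ (balance (@ract X k d) (@arr_act k n d)) T (fun z => g z.1 z.2) _
  (x, arr_mk y r).
rewrite /= => <-; first by case: (rep _).
move=> _ _ [x1 s v] /=; elim/arr_ind: v => p1 y1 r1.
by rewrite arr_actE !gE f_block.
Qed.

Definition circ_act n d (u : circ_simp n d) (s : 'S_n) : circ_simp n d :=
  circ_rec (fun k x p y r => circ_mk x y (pcomp r s)) u.

Lemma circ_actE n d k x p y r s :
  circ_act (@circ_mk n d k x p y r) s = circ_mk x y (pcomp r s).
Proof.
rewrite /circ_act circ_recE //; split=> [{}k {}x {}p {}y t {}r|{}k {}x t {}p {}y {}r].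
  by rewrite circ_glue_bsum pcompA.
by rewrite circ_glue_block pcompA.
Qed.

End CompSimp.

Section CompMap.
Variables (X X' Y Y' : symSeq) (d d' : nat).
Variables (f : forall n, X n d -> X' n d') (g : forall n, Y n d -> Y' n d').

Definition circ_map n (u : circ_simp X Y n d) : circ_simp X' Y' n d' :=
  circ_rec (fun k x p y r => circ_mk (f x) (fun i => g (y i)) r) u.

Hypothesis f_act : forall n (x : X n d) (s : 'S_n), f (ract x s) = ract (f x) s.
Hypothesis g_act : forall n (y : Y n d) (s : 'S_n), g (ract y s) = ract (g y) s.

Lemma circ_mapE n k x (p : partn k n) y r :
  circ_map (@circ_mk X Y n d k x p y r) = circ_mk (f x) (fun i => g (y i)) r.
Proof.
rewrite /circ_map circ_recE //; split=> [{}k {}x {}p {}y t {}r|{}k {}x t {}p {}y {}r].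
  rewrite -circ_glue_bsum; congr circ_mk.
  by apply: functional_extensionality_dep => i; apply: g_act.
by rewrite f_act circ_glue_block.
Qed.

Lemma circ_map_act n u (s : 'S_n) : circ_map (circ_act u s) = circ_act (circ_map u) s.
Proof. by elim/circ_ind: u => k x p y r; rewrite !(circ_actE, circ_mapE). Qed.

End CompMap.

Section Comp.
Variables X Y : symSeq.

Definition circ_sop n d e (h : {omorphism 'I_d.+1 -> 'I_e.+1}) :
    circ_simp X Y n e -> circ_simp X Y n d :=
  circ_map (fun m => @sop (X m) d e h) (fun m => @sop (Y m) d e h) (n := n).

Lemma circ_sopE n d e (h : {omorphism 'I_d.+1 -> 'I_e.+1}) k x (p : partn k n) y r :
  circ_sop h (@circ_mk X Y n e k x p y r) =
  circ_mk (sop h x) (fun i => sop h (y i)) r.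
Proof. by rewrite /circ_sop circ_mapE // => *; apply: ract_sop. Qed.

Lemma circ_sop_id n d (u : circ_simp X Y n d) : circ_sop idfun u = u.
Proof.
elim/circ_ind: u => k x p y r; rewrite circ_sopE sop_id; congr circ_mk.
by apply: functional_extensionality_dep => i; rewrite sop_id.
Qed.

Lemma circ_sop_comp n d e f (g : {omorphism 'I_e.+1 -> 'I_f.+1})
    (h : {omorphism 'I_d.+1 -> 'I_e.+1}) (u : circ_simp X Y n f) :
  circ_sop (g \o h) u = circ_sop h (circ_sop g u).
Proof.
elim/circ_ind: u => k x p y r; rewrite !circ_sopE sop_comp; congr circ_mk.
by apply: functional_extensionality_dep => i; rewrite sop_comp.
Qed.

Definition circ_obj n : sSet := SSet (@circ_sop_id n) (@circ_sop_comp n).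

Lemma circ_act1 n d (u : circ_obj n d) : circ_act u 1%g = u.
Proof. by elim/circ_ind: u => k x p y r; rewrite circ_actE pcomp1. Qed.

Lemma circ_act_comp n d (u : circ_obj n d) (s t : 'S_n) :
  circ_act u (pcomp s t) = circ_act (circ_act u s) t.
Proof. by elim/circ_ind: u => k x p y r; rewrite !circ_actE pcompA. Qed.

Lemma circ_act_sop n d e (h : {omorphism 'I_d.+1 -> 'I_e.+1}) (u : circ_obj n e)
  (s : 'S_n) : sop h (circ_act u s : circ_obj n e) = circ_act (sop h u : circ_obj n d) s.
Proof. by apply: circ_map_act => *; apply: ract_sop. Qed.

Definition circ : symSeq := SymSeq circ_act1 circ_act_comp circ_act_sop.

Lemma sop_circE n d e (h : {omorphism 'I_d.+1 -> 'I_e.+1}) k x (p : partn k n) y r :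
  sop h (@circ_mk X Y n e k x p y r : circ n e) =
  circ_mk (sop h x) (fun i => sop h (y i)) r.
Proof. exact: circ_sopE. Qed.

End Comp.

Section CompHom.
Variables (X X' Y Y' : symSeq) (f : symHom X X') (g : symHom Y Y').

Definition circ_hom_fun n d : circ X Y n d -> circ X' Y' n d :=
  circ_map (fun m => @hom _ _ f m d) (fun m => @hom _ _ g m d) (n := n).

Lemma circ_hom_sop n d e (h : {omorphism 'I_d.+1 -> 'I_e.+1}) (u : circ X Y n e) :
  circ_hom_fun (sop h u) = sop h (circ_hom_fun u).
Proof.
elim/circ_ind: u => k x p y r; rewrite sop_circE /circ_hom_fun.
rewrite !circ_mapE ?sop_circE; try by move=> *; apply: hom_act.
rewrite hom_sop; congr circ_mk.
by apply: functional_extensionality_dep => i; rewrite hom_sop.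
Qed.

Lemma circ_hom_act n d (u : circ X Y n d) (s : 'S_n) :
  circ_hom_fun (ract u s) = ract (circ_hom_fun u) s.
Proof. by apply: circ_map_act => *; apply: hom_act. Qed.

Definition circ_hom : symHom (circ X Y) (circ X' Y') :=
  SymHom circ_hom_sop circ_hom_act.

End CompHom.

Section BoxSimp.
Variables X Y : symSeq.

Definition pair_act l m d (z : X l d * Y m d) (st : 'S_l * 'S_m) : X l d * Y m d :=
  (ract z.1 st.1, ract z.2 st.2).

Definition square_simp n d : Type :=
  {q : factn n &
    balanced (@pair_act (frow q) (fcol q) d) (fun st (r : 'S_n) => pcomp (nu st) r)}.

Definition square_mk n d (q : factn n) (x : X (frow q) d) (y : Y (fcol q) d) (r : 'S_n) :
  square_simp n d := existT _ q (cls _ ((x, y), r)).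

Lemma square_glue n d (q : factn n) (x : X (frow q) d) (y : Y (fcol q) d) s t r :
  square_mk (ract x s) (ract y t) r = square_mk x y (pcomp (nu (s, t)) r).
Proof.
congr existT; apply: cls_eq.
exact: (Balance (@pair_act (frow q) (fcol q) d)
  (fun st (r : 'S_n) => pcomp (nu st) r) (x, y) (s, t) r).
Qed.

Lemma square_ind n d (P : square_simp n d -> Prop) :
  (forall q x y r, P (@square_mk n d q x y r)) -> forall u, P u.
Proof. by move=> IH [q c]; rewrite -[c]repK; case: (rep c) => [[x y] r]; apply: IH. Qed.

Definition square_rec n d (T : Type)
    (f : forall (q : factn n) (x : X (frow q) d) (y : Y (fcol q) d) (r : 'S_n), T)
    (u : square_simp n d) : T :=
  let (q, c) := u in let: ((x, y), r) := rep c in f q x y r.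

Definition square_inv n d (T : Type)
    (f : forall (q : factn n) (x : X (frow q) d) (y : Y (fcol q) d) (r : 'S_n), T) :=
  forall q x y s t r, f q (ract x s) (ract y t) r = f q x y (pcomp (nu (s, t)) r).

Lemma square_recE n d (T : Type) f : @square_inv n d T f ->
  forall q x y r, square_rec f (@square_mk n d q x y r) = f q x y r.
Proof.
move=> finv q x y r; rewrite /square_rec /square_mk.
pose h (z : (X (frow q) d * Y (fcol q) d) * 'S_n) := f q z.1.1 z.1.2 z.2.
rewrite -[RHS]/(h ((x, y), r)) -[RHS](cls_inv (R := balance
  (@pair_act (frow q) (fcol q) d) (fun st (r : 'S_n) => pcomp (nu st) r))).
  by rewrite /h; case: (rep _) => [[]].
by move=> _ _ [[x1 y1] [s t] r1]; rewrite /h /= finv.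
Qed.

Definition square_act n d (u : square_simp n d) (s : 'S_n) : square_simp n d :=
  square_rec (fun q x y r => square_mk x y (pcomp r s)) u.

Lemma square_actE n d q x y r s :
  square_act (@square_mk n d q x y r) s = square_mk x y (pcomp r s).
Proof.
by rewrite /square_act square_recE // => {}q {}x {}y t t' {}r; rewrite square_glue pcompA.
Qed.

End BoxSimp.

Section BoxMap.
Variables (X X' Y Y' : symSeq) (d d' : nat).
Variables (f : forall n, X n d -> X' n d') (g : forall n, Y n d -> Y' n d').

Definition square_map n (u : square_simp X Y n d) : square_simp X' Y' n d' :=
  square_rec (fun q x y r => square_mk (f x) (g y) r) u.

Hypothesis f_act : forall n (x : X n d) (s : 'S_n), f (ract x s) = ract (f x) s.
Hypothesis g_act : forall n (y : Y n d) (s : 'S_n), g (ract y s) = ract (g y) s.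

Lemma square_mapE n q x y r :
  square_map (@square_mk X Y n d q x y r) = square_mk (f x) (g y) r.
Proof.
rewrite /square_map square_recE // => {}q {}x {}y s t {}r.
by rewrite f_act g_act square_glue.
Qed.

Lemma square_map_act n u (s : 'S_n) : square_map (square_act u s) = square_act (square_map u) s.
Proof. by elim/square_ind: u => q x y r; rewrite !(square_actE, square_mapE). Qed.

End BoxMap.

Section Box.
Variables X Y : symSeq.

Definition square_sop n d e (h : {omorphism 'I_d.+1 -> 'I_e.+1}) :
    square_simp X Y n e -> square_simp X Y n d :=
  square_map (fun m => @sop (X m) d e h) (fun m => @sop (Y m) d e h) (n := n).

Lemma square_sopE n d e (h : {omorphism 'I_d.+1 -> 'I_e.+1}) q x y r :
  square_sop h (@square_mk X Y n e q x y r) = square_mk (sop h x) (sop h y) r.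
Proof. by rewrite /square_sop square_mapE // => *; apply: ract_sop. Qed.

Lemma square_sop_id n d (u : square_simp X Y n d) : square_sop idfun u = u.
Proof. by elim/square_ind: u => q x y r; rewrite square_sopE !sop_id. Qed.

Lemma square_sop_comp n d e f (g : {omorphism 'I_e.+1 -> 'I_f.+1})
    (h : {omorphism 'I_d.+1 -> 'I_e.+1}) (u : square_simp X Y n f) :
  square_sop (g \o h) u = square_sop h (square_sop g u).
Proof. by elim/square_ind: u => q x y r; rewrite !square_sopE !sop_comp. Qed.

Definition square_obj n : sSet := SSet (@square_sop_id n) (@square_sop_comp n).

Lemma square_act1 n d (u : square_obj n d) : square_act u 1%g = u.
Proof. by elim/square_ind: u => q x y r; rewrite square_actE pcomp1. Qed.

Lemma square_act_comp n d (u : square_obj n d) (s t : 'S_n) :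
  square_act u (pcomp s t) = square_act (square_act u s) t.
Proof. by elim/square_ind: u => q x y r; rewrite !square_actE pcompA. Qed.

Lemma square_act_sop n d e (h : {omorphism 'I_d.+1 -> 'I_e.+1}) (u : square_obj n e)
  (s : 'S_n) : sop h (square_act u s : square_obj n e) = square_act (sop h u : square_obj n d) s.
Proof. by apply: square_map_act => *; apply: ract_sop. Qed.

Definition square : symSeq := SymSeq square_act1 square_act_comp square_act_sop.

Lemma sop_squareE n d e (h : {omorphism 'I_d.+1 -> 'I_e.+1}) q x y r :
  sop h (@square_mk X Y n e q x y r : square n e) = square_mk (sop h x) (sop h y) r.
Proof. exact: square_sopE. Qed.

End Box.

Section BoxHom.
Variables (X X' Y Y' : symSeq) (f : symHom X X') (g : symHom Y Y').

Definition square_hom_fun n d : square X Y n d -> square X' Y' n d :=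
  square_map (fun m => @hom _ _ f m d) (fun m => @hom _ _ g m d) (n := n).

Lemma square_hom_sop n d e (h : {omorphism 'I_d.+1 -> 'I_e.+1}) (u : square X Y n e) :
  square_hom_fun (sop h u) = sop h (square_hom_fun u).
Proof.
elim/square_ind: u => q x y r; rewrite sop_squareE /square_hom_fun.
by rewrite !square_mapE ?sop_squareE ?hom_sop // => *; apply: hom_act.
Qed.

Lemma square_hom_act n d (u : square X Y n d) (s : 'S_n) :
  square_hom_fun (ract u s) = ract (square_hom_fun u) s.
Proof. by apply: square_map_act => *; apply: hom_act. Qed.

Definition square_hom : symHom (square X Y) (square X' Y') :=
  SymHom square_hom_sop square_hom_act.

End BoxHom.

Section AssocPerm.
Variables (k l n : nat) (p : partn l k) (q : partn k n) (o : partn l n).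
Variable a : {i : 'I_l & 'I_(p i)} -> 'I_k.
Hypothesis a_inj : injective a.
Hypothesis oE : forall i, \sum_(j < p i) q (a (Tagged (fun i => 'I_(p i)) j)) = o i.

Definition assoc_in i : partn (p i) (o i) := Partn (oE i).

(* For [q] indexed by the pairs [(i, j)] through [a], regrouping its blocks along [i] gives
   [o]; [assoc_inv] sends the element [(i, (j, b))] of [o] to the element
   [(a (i, j), b)] of [q]. *)
Definition assoc_inv (r : 'I_n) : 'I_n :=
  let x := coord o r in
  let y := coord (assoc_in (tag x)) (tagged x) in
  pos (Tagged (fun c => 'I_(q c))
    (tagged y : 'I_(q (a (Tagged (fun i => 'I_(p i)) (tag y)))))).

Lemma assoc_invE i (y : {j : 'I_(p i) & 'I_(assoc_in i j)}) :
  assoc_inv (pos (Tagged (fun i => 'I_(o i)) (pos y))) =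
  pos (Tagged (fun c => 'I_(q c))
    (tagged y : 'I_(q (a (Tagged (fun i => 'I_(p i)) (tag y)))))).
Proof. by rewrite /assoc_inv posK /= posK. Qed.

Lemma assoc_posP (r : 'I_n) : exists i (y : {j : 'I_(p i) & 'I_(assoc_in i j)}),
  r = pos (Tagged (fun i => 'I_(o i)) (pos y)).
Proof.
exists (tag (coord o r)), (coord (assoc_in (tag (coord o r))) (tagged (coord o r))).
by rewrite coordK -[LHS](coordK o); case: (coord o r).
Qed.

Lemma assoc_inv_inj : injective assoc_inv.
Proof.
move=> r r'.
have [i [[j b] ->]] := assoc_posP r; have [i' [[j' b'] ->]] := assoc_posP r'.
rewrite !assoc_invE => /(can_inj (@posK _ _ q)) /= E.
have Ea := a_inj (congr1 tag E : a _ = a _).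
have Ei : i = i' := congr1 tag Ea.
case: _ / Ei in j' b' E Ea *; have /= Ej := eq_from_Tagged Ea.
by case: _ / Ej in b' E {Ea} *; have /= -> := eq_from_Tagged E.
Qed.

Definition assoc_perm : 'S_n := (perm assoc_inv_inj)^-1%g.

Lemma assoc_permV i (y : {j : 'I_(p i) & 'I_(assoc_in i j)}) :
  assoc_perm^-1%g (pos (Tagged (fun i => 'I_(o i)) (pos y))) =
  pos (Tagged (fun c => 'I_(q c))
    (tagged y : 'I_(q (a (Tagged (fun i => 'I_(p i)) (tag y)))))).
Proof. by rewrite /assoc_perm invgK permE assoc_invE. Qed.

End AssocPerm.

Section Assoc.
Variables X Y Z : symSeq.

Definition assoc_mk k l n d (x : X l d) (p : partn l k) (y : forall i, Y (p i) d)
    (q : partn k n) (z : forall c, Z (q c) d) (r : 'S_n) (o : partn l n) a a_inj oE :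
    circ X (circ Y Z) n d :=
  @circ_mk X (circ Y Z) n d l x o
    (fun i => @circ_mk Y Z (o i) d (p i) (y i) (assoc_in oE i)
      (fun j => z (a (Tagged (fun i => 'I_(p i)) j))) 1%g)
    (pcomp (@assoc_perm k l n p q o a a_inj oE) r).

Lemma partn_eq k n (p p' : partn k n) : p =1 p' -> p = p'.
Proof.
case: p p' => [f fE] [f' fE'] /= /funext E; subst f'.
by congr Partn; apply: Prop_irrelevance.
Qed.

Lemma assoc_mk_eq k l n d (x : X l d) (p : partn l k) (y : forall i, Y (p i) d)
    (q : partn k n) (z : forall c, Z (q c) d) (r : 'S_n) o a a_inj oE o' a' a_inj' oE' :
  a =1 a' ->
  assoc_mk x y z r (o := o) (a := a) a_inj oE =
  assoc_mk x y z r (o := o') (a := a') a_inj' oE'.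
Proof.
move/funext => E; subst a'.
have E : o = o' by apply: partn_eq => i; rewrite -oE -oE'.
by subst o'; congr assoc_mk; apply: Prop_irrelevance.
Qed.

Section AssocRep.
Variables (k l n : nat) (p : partn l k) (s : 'S_k) (q : partn k n).

(* In [((x; y_i; s); z_c; r)], the [j]-th input of [y_i] is grafted onto the [z_c] with
   [c = assoc_idx (i, j)]; the result is
   [(x; (y_i; z_(assoc_idx (i, j)); 1); assoc_perm * r)], see [assoc_mk] and [assocE]. *)
Definition assoc_idx (v : {i : 'I_l & 'I_(p i)}) : 'I_k := s^-1%g (pos v).

Lemma assoc_idx_inj : injective assoc_idx.
Proof. by move=> v w /perm_inj /(can_inj (@posK _ _ p)). Qed.

Definition assoc_size (i : 'I_l) : nat :=
  \sum_(j < p i) q (assoc_idx (Tagged (fun i => 'I_(p i)) j)).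

Lemma assoc_sizeE : \sum_(i < l) assoc_size i = n.
Proof.
rewrite -[RHS](partE q) (reindex assoc_idx) /=; last first.
  exists (fun c => coord p (s c)) => v _; first by rewrite /assoc_idx permKV posK.
  by rewrite /assoc_idx coordK permK.
rewrite /assoc_size (sig_big_dep (fun=> true) (fun _ _ => true)
  (fun i j => q (assoc_idx (Tagged (fun i => 'I_(p i)) j)))) /=.
by apply: eq_bigr => -[].
Qed.

Definition assoc_out : partn l n := Partn assoc_sizeE.

End AssocRep.

(* The canonical isomorphism from [(X o Y) o Z] to [X o (Y o Z)]. *)
Definition assoc_fun n d (u : circ (circ X Y) Z n d) : circ X (circ Y Z) n d :=
  @circ_rec (circ X Y) Z n d _ (fun k v q z r =>
    @circ_rec X Y k d _ (fun l x p y s =>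
      assoc_mk x y z r (@assoc_idx_inj k l p s) (o := assoc_out p s q) (fun=> erefl)) v) u.

Lemma assoc_glue_bsum_in k l n d (x : X l d) (p : partn l k) (y : forall i, Y (p i) d) t
    (q : partn k n) (z : forall c, Z (q c) d) (r : 'S_n) s :
  assoc_mk x (fam_act y t) z r (@assoc_idx_inj k l p s) (o := assoc_out p s q)
    (fun=> erefl) =
  assoc_mk x y z r (@assoc_idx_inj k l p (pcomp (bsum t) s))
    (o := assoc_out p (pcomp (bsum t) s) q) (fun=> erefl).
Proof.
have idxE (v : {i : 'I_l & 'I_(p i)}) : assoc_idx (pcomp (bsum t) s) v =
    assoc_idx s (Tagged (fun i => 'I_(p i)) ((t (tag v))^-1%g (tagged v))).
  by rewrite /assoc_idx /pcomp invMg permM bsumV.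
pose a (v : {i : 'I_l & 'I_(p i)}) := assoc_idx s (Tagged (fun i => 'I_(p i)) ((t (tag v))^-1%g (tagged v))).
have a_inj : injective a by move=> v w; rewrite /a -!idxE; apply: assoc_idx_inj.
have oE i : \sum_(j < p i) q (a (Tagged (fun i => 'I_(p i)) j)) = assoc_out p s q i.
  rewrite /a /= /assoc_size [RHS](reindex_inj (@perm_inj _ (t i)^-1%g)) /=.
  exact: eq_bigr.
rewrite -[RHS](assoc_mk_eq x y z r a_inj oE); last by move=> v; rewrite idxE.
pose b i := block_perm (t i) (assoc_in (fun i => erefl (assoc_out p s q i)) i).
rewrite /assoc_mk.
have -> : pcomp (assoc_perm a_inj oE) r =
    pcomp (bsum b) (pcomp (assoc_perm (@assoc_idx_inj k l p s)
      (o := assoc_out p s q) (q := q) (fun=> erefl)) r).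
  rewrite pcompA; congr pcomp; apply: invg_inj; apply/permP => e.
  have [i [v ->]] := assoc_posP oE e.
  rewrite assoc_permV /pcomp invMg permM bsumV /=.
  rewrite (_ : pos v = @pos _ _ (partn_act (t i) (assoc_in (o := assoc_out p s q)
    (fun i => erefl) i)) v); last by apply: val_inj.
  by rewrite block_permV assoc_permV.
rewrite -[RHS](@circ_glue_bsum X (circ Y Z)); congr circ_mk.
apply: functional_extensionality_dep => i.
rewrite /fam_act /= [RHS]circ_actE circ_glue_block pcomp1 /pcomp mulg1 /b.
rewrite /partn_act /assoc_in /=.
move: (oE i) (partn_actP _ _) => h h'; by rewrite (Prop_irrelevance h h').
Qed.

Lemma assoc_glue_block_in k l n d (x : X l d) t (p : partn l k) (y : forall i, Y (p i) d)
    (q : partn k n) (z : forall c, Z (q c) d) (r : 'S_n) s :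
  assoc_mk (ract x t) y z r (@assoc_idx_inj k l p s) (o := assoc_out p s q)
    (fun=> erefl) =
  @assoc_mk k l n d x (partn_act t p) (fun i => y (t^-1%g i)) q z r _ _
    (@assoc_idx_inj k l (partn_act t p) (pcomp (block_perm t p) s))
    (fun i => erefl (assoc_out (partn_act t p) (pcomp (block_perm t p) s) q i)).
Proof.
have idxE (v : {i : 'I_l & 'I_(partn_act t p i)}) :
    assoc_idx (pcomp (block_perm t p) s) v =
    assoc_idx s (Tagged (fun i => 'I_(p i)) (tagged v : 'I_(p (t^-1%g (tag v))))).
  by rewrite /assoc_idx /pcomp invMg permM block_permV.
pose a (v : {i : 'I_l & 'I_(partn_act t p i)}) :=
  assoc_idx s (Tagged (fun i => 'I_(p i)) (tagged v : 'I_(p (t^-1%g (tag v))))).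
have a_inj : injective a by move=> v w; rewrite /a -!idxE; apply: assoc_idx_inj.
pose o := partn_act t (assoc_out p s q).
have oE i : \sum_(j < partn_act t p i)
    q (a (Tagged (fun i => 'I_(partn_act t p i)) j)) = o i by [].
rewrite -[RHS](assoc_mk_eq x _ z r a_inj oE); last by move=> v; rewrite idxE.
rewrite /assoc_mk [LHS](@circ_glue_block X (circ Y Z)) pcompA.
have -> : pcomp (block_perm t (assoc_out p s q)) (assoc_perm (@assoc_idx_inj k l p s)
      (o := assoc_out p s q) (q := q) (fun=> erefl)) = assoc_perm a_inj oE.
  apply: invg_inj; apply/permP => e; have [i [v ->]] := assoc_posP oE e.
  rewrite assoc_permV /pcomp invMg permM block_permV /=.
  have E : pos v = @pos _ _ (assoc_in (o := assoc_out p s q)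
    (fun i => erefl) (t^-1%g i)) v by apply: val_inj.
  by rewrite E assoc_permV.
congr circ_mk; apply: functional_extensionality_dep => i.
rewrite /assoc_in /=; move: (oE i) => h.
by rewrite (Prop_irrelevance h erefl).
Qed.

Lemma assoc_glue_bsum k l n d (x : X l d) (p : partn l k) (y : forall i, Y (p i) d)
    (q : partn k n) (z : forall c, Z (q c) d) t (r : 'S_n) s :
  assoc_mk x y (fam_act z t) r (@assoc_idx_inj k l p s) (o := assoc_out p s q)
    (fun=> erefl) =
  assoc_mk x y z (pcomp (bsum t) r) (@assoc_idx_inj k l p s) (o := assoc_out p s q)
    (fun=> erefl).
Proof.
pose u i := bsum (p := assoc_in (o := assoc_out p s q) (fun i => erefl) i)
  (fun j => t (assoc_idx s (Tagged (fun i => 'I_(p i)) j))).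
rewrite /assoc_mk [in RHS]pcompA.
have -> : pcomp (assoc_perm (@assoc_idx_inj k l p s)
      (o := assoc_out p s q) (q := q) (fun=> erefl)) (bsum t) =
    pcomp (bsum u) (assoc_perm (@assoc_idx_inj k l p s)
      (o := assoc_out p s q) (q := q) (fun=> erefl)).
  apply: invg_inj; apply/permP => e.
  have [i [v ->]] := assoc_posP (fun i => erefl (assoc_out p s q i)) e.
  by rewrite /pcomp !invMg !permM assoc_permV !bsumV /= assoc_permV.
rewrite -pcompA -[RHS](@circ_glue_bsum X (circ Y Z)); congr circ_mk.
apply: functional_extensionality_dep => i.
rewrite /fam_act /= [RHS]circ_actE /pcomp mulg1.
by rewrite -[u i]mul1g -[RHS](circ_glue_bsum (y i)).
Qed.

Lemma assoc_glue_block k l n d (x : X l d) (p : partn l k) (y : forall i, Y (p i) d)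
    (q : partn k n) (z : forall c, Z (q c) d) t (r : 'S_n) s :
  assoc_mk x y z r (@assoc_idx_inj k l p (pcomp s t)) (o := assoc_out p (pcomp s t) q)
    (fun=> erefl) =
  @assoc_mk k l n d x p y (partn_act t q) (fun i => z (t^-1%g i))
    (pcomp (block_perm t q) r) _ _ (@assoc_idx_inj k l p s)
    (fun i => erefl (assoc_out p s (partn_act t q) i)).
Proof.
have idxE (v : {i : 'I_l & 'I_(p i)}) :
    assoc_idx (pcomp s t) v = t^-1%g (assoc_idx s v).
  by rewrite /assoc_idx /pcomp invMg permM.
pose a (v : {i : 'I_l & 'I_(p i)}) := t^-1%g (assoc_idx s v).
have a_inj : injective a by move=> v w /perm_inj /assoc_idx_inj.
pose o := assoc_out p s (partn_act t q).
have oE i : \sum_(j < p i) q (a (Tagged (fun i => 'I_(p i)) j)) = o i by [].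
rewrite -[LHS](assoc_mk_eq x y z r a_inj oE); last by move=> v; rewrite idxE.
rewrite /assoc_mk [in RHS]pcompA.
have -> : pcomp (assoc_perm (@assoc_idx_inj k l p s) (q := partn_act t q)
      (o := assoc_out p s (partn_act t q)) (fun=> erefl)) (block_perm t q) =
    assoc_perm a_inj oE.
  apply: invg_inj; apply/permP => e; have [i [v ->]] := assoc_posP oE e.
  rewrite assoc_permV /pcomp invMg permM.
  have E : pos v = @pos _ _ (assoc_in (q := partn_act t q)
    (o := assoc_out p s (partn_act t q)) (fun i => erefl) i) v by apply: val_inj.
  rewrite E (@assoc_permV k l n p (partn_act t q) (assoc_out p s (partn_act t q)) _
    (@assoc_idx_inj k l p s) (fun i => erefl) i v).
  exact: (@block_permV _ _ t q).
congr circ_mk; apply: functional_extensionality_dep => i.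
rewrite /assoc_in /=; move: (oE i) => h.
by rewrite (Prop_irrelevance h erefl).
Qed.

Lemma assoc_rep_inv k n d (q : partn k n) (z : forall c, Z (q c) d) (r : 'S_n) :
  @circ_inv X Y k d _ (fun l x p y s => assoc_mk x y z r (@assoc_idx_inj k l p s)
    (o := assoc_out p s q) (fun=> erefl)).
Proof.
split=> [l x p y t s|l x t p y s]; first exact: assoc_glue_bsum_in.
exact: assoc_glue_block_in.
Qed.

Lemma assocE k l n d (x : X l d) (p : partn l k) (y : forall i, Y (p i) d) s
    (q : partn k n) (z : forall c, Z (q c) d) (r : 'S_n) :
  assoc_fun (@circ_mk (circ X Y) Z n d k (circ_mk x y s) q z r) =
  assoc_mk x y z r (@assoc_idx_inj k l p s) (o := assoc_out p s q) (fun=> erefl).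
Proof.
rewrite /assoc_fun circ_recE ?(circ_recE (assoc_rep_inv z r)) //.
split=> {k l x p y s q z r} [k v q z t r|k v t q z r].
  elim/circ_ind: v => l x p y s.
  by rewrite !(circ_recE (assoc_rep_inv _ _)) assoc_glue_bsum.
elim/circ_ind: v => l x p y s.
rewrite [ract _ _]circ_actE.
by rewrite !(circ_recE (assoc_rep_inv _ _)) assoc_glue_block.
Qed.

Lemma assoc_sop n d e (h : {omorphism 'I_d.+1 -> 'I_e.+1}) (u : circ (circ X Y) Z n e) :
  assoc_fun (sop h u) = sop h (assoc_fun u).
Proof.
elim/circ_ind: u => k v q z r; elim/circ_ind: v => l x p y s.
rewrite assocE sop_circE sop_circE assocE /assoc_mk sop_circE.
congr circ_mk; apply: functional_extensionality_dep => i.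
by rewrite sop_circE.
Qed.

Lemma assoc_act n d (u : circ (circ X Y) Z n d) (t : 'S_n) :
  assoc_fun (ract u t) = ract (assoc_fun u) t.
Proof.
elim/circ_ind: u => k v q z r; elim/circ_ind: v => l x p y s.
by rewrite [ract _ _]circ_actE !assocE /assoc_mk [RHS]circ_actE pcompA.
Qed.

Definition assoc : symHom (circ (circ X Y) Z) (circ X (circ Y Z)) :=
  SymHom assoc_sop assoc_act.

End Assoc.

Declare Scope symseq_scope.
Delimit Scope symseq_scope with symseq.
Notation "X '\circ' Y" := (circ X Y) (at level 40, left associativity) : symseq_scope.
Notation "X '\square' Y" := (square X Y) (at level 40, left associativity) : symseq_scope.

(* Main.v *)
(** A simplex of a composition product is an operation [x], operations [y i] grafted on its
    inputs, and a labelling of the inputs [(i, a)] of the [y i] by ['I_n]; the equivalence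
    relation relabels.  Similarly for [\square], with inputs [(a, b)] of a pair.  Then [sigma]
    sends [((v; w; s), (y; z; t); r)] to [((v, y); (w i, z j)_(i, j))] with the input
    [((i, j), (a, b))] labelled [r (s (i, a), t (j, b))].  Both composites of the theorem
    yield the same operations and the same labelling of the innermost inputs; they differ
    only in how the two pairs of nested indices of the middle level are ordered, which is
    absorbed by the relabelling [circ_circ_eq]. *)
From mathcomp Require Import all_boot all_order all_fingroup.
From mathcomp Require Import boolp.
Require Import Defs.
Local Open Scope symseq_scope.

Set Implicit Arguments.
Unset Strict Implicit.
Unset Printing Implicit Defensive.

(** * Labels of inputs and equality of simplices of a composition product *)

Section Labels.
Variables k n : nat.
Implicit Types (p : partn k n) (r s : 'S_n).

(* The label of the input [x] in [circ_mk _ _ r]: permutations act on the right, whence the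
   inverse. *)
Definition lab p r (x : {i : 'I_k & 'I_(p i)}) : 'I_n := r^-1%g (pos x).

Lemma lab1 p x : @lab p 1%g x = pos x.
Proof. by rewrite /lab invg1 perm1. Qed.

Lemma lab_pcomp p r s x : @lab p (pcomp r s) x = s^-1%g (lab r x).
Proof. by rewrite /lab /pcomp invMg permM. Qed.

Lemma lab_bsum p (t : forall i, 'S_(p i)) x :
  lab (bsum t) x = pos (Tagged (fun i => 'I_(p i)) ((t (tag x))^-1%g (tagged x))).
Proof. exact: bsumV. Qed.

Lemma lab_block_perm p (s : 'S_k) x :
  @lab (partn_act s p) (block_perm s p) x =
  pos (Tagged (fun i => 'I_(p i)) (tagged x : 'I_(p (s^-1%g (tag x))))).
Proof. exact: block_permV. Qed.

(** The types of [a] and [a'] are convertible; comparing them through [val] matches the form of the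
    hypotheses of [sigma_mk_block]. *)
Lemma lab_block_pcomp p (s : 'S_k) r i (a : 'I_(p (s^-1%g i))) (a' : 'I_(partn_act s p i)) :
  val a = val a' ->
  lab r (Tagged (fun i => 'I_(p i)) a) =
  lab (pcomp (block_perm s p) r) (Tagged (fun i => 'I_(partn_act s p i)) a').
Proof. by move/val_inj => ->; rewrite lab_pcomp lab_block_perm. Qed.

End Labels.

(** A permutation is determined by the labels it gives. The hypotheses use [existT] and [val]
    because corresponding blocks may have sizes that are equal without being convertible. *)
Lemma circ_mk_eq (X Y : symSeq) n d k (x : X k d) (p p' : partn k n)
    (y : forall i, Y (p i) d) (y' : forall i, Y (p' i) d) (r r' : 'S_n) :
  (forall i, existT (fun m => Y m d) (p i) (y i) = existT _ (p' i) (y' i)) ->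
  (forall i (a : 'I_(p i)) (a' : 'I_(p' i)), val a = val a' ->
    lab r (Tagged (fun i => 'I_(p i)) a) = lab r' (Tagged (fun i => 'I_(p' i)) a')) ->
  circ_mk x y r = circ_mk x y' r'.
Proof.
move=> yE rE; have E : p = p' by apply: partn_eq => i; exact: (congr1 (@projT1 _ _) (yE i)).
subst p'; have -> : y = y'.
  by apply: functional_extensionality_dep => i; have /= := eq_from_Tagged (yE i).
congr circ_mk; apply: invg_inj; apply/permP => e.
by rewrite -(coordK p e); case: (coord p e) => i a; apply: rE.
Qed.

(* Replacing the operation [y i] by [y i t_i] is compensated by [t_i] on the outer
   labelling: only the composite labelling of the innermost inputs matters. *)
Lemma circ_circ_eq (X Y Z : symSeq) n d l (x : X l d) (k : 'I_l -> nat)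
    (y : forall i, Y (k i) d) (o o' : partn l n)
    (p : forall i, partn (k i) (o i)) (p' : forall i, partn (k i) (o' i))
    (z : forall i j, Z (p i j) d) (z' : forall i j, Z (p' i j) d)
    (s : forall i, 'S_(o i)) (s' : forall i, 'S_(o' i)) (r r' : 'S_n) :
  (forall i j, existT (fun m => Z m d) (p i j) (z i j) = existT _ (p' i j) (z' i j)) ->
  (forall i j (a : 'I_(p i j)) (a' : 'I_(p' i j)), val a = val a' ->
    lab r (Tagged (fun i => 'I_(o i)) (lab (s i) (Tagged (fun j => 'I_(p i j)) a))) =
    lab r' (Tagged (fun i => 'I_(o' i)) (lab (s' i) (Tagged (fun j => 'I_(p' i j)) a')))) ->
  @circ_mk X (Y \circ Z) n d l x o (fun i => circ_mk (y i) (z i) (s i)) r =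
  @circ_mk X (Y \circ Z) n d l x o' (fun i => circ_mk (y i) (z' i) (s' i)) r'.
Proof.
move=> zE rE.
have pE i j : p i j = p' i j := congr1 (@projT1 _ _) (zE i j).
have E : o = o'.
  apply: partn_eq => i; rewrite -(partE (p i)) -(partE (p' i)).
  by apply: eq_bigr => j _.
subst o'.
have E : p = p' by apply: functional_extensionality_dep => i; apply: partn_eq.
subst p'.
have <- : z = z'.
  apply: functional_extensionality_dep => i; apply: functional_extensionality_dep => j.
  by have /= := eq_from_Tagged (zE i j).
have mkE (t : forall i, 'S_(o i)) (e : 'S_n) :
    @circ_mk X (Y \circ Z) n d l x o (fun i => circ_mk (y i) (z i) (t i)) e =
    @circ_mk X (Y \circ Z) n d l x o (fun i => circ_mk (y i) (z i) 1%g) (pcomp (bsum t) e).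
  rewrite -[RHS](@circ_glue_bsum X (Y \circ Z)); congr circ_mk.
  apply: functional_extensionality_dep => i.
  by rewrite /fam_act [RHS]circ_actE /pcomp mulg1.
rewrite [LHS]mkE [RHS]mkE; apply: circ_mk_eq => // i a a' /val_inj <-.
rewrite !lab_pcomp !lab_bsum /= -(coordK (p i) a); case: (coord _ a) => j b.
exact: rE.
Qed.

(** * The shuffle of two pairs of indices *)

Definition fprod l m : factn (l * m) := Factn (erefl (l * m)).

(** Coordinates are quotient and remainder by the number of columns, whence the hypothesis
    [m = m']. *)
Lemma mcoord_eq l l' m m' (e : 'I_(l * m)) (e' : 'I_(l' * m')) :
  m = m' -> val e = val e' ->
  val (mcoord (fprod l m) e).1 = val (mcoord (fprod l' m') e').1 /\
  val (mcoord (fprod l m) e).2 = val (mcoord (fprod l' m') e').2.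
Proof. by move=> Em /= E; rewrite /mcoord /= E Em. Qed.

(* Otherwise [/=] unfolds [(mcoord _ _).1] to an [Ordinal]. *)
#[local] Opaque mcoord mpos.

Lemma nuV n (q : factn n) s t x : (@nu n q (s, t))^-1%g (mpos x) = mpos (s^-1%g x.1, t^-1%g x.2).
Proof. by apply: (@perm_inj _ (nu (s, t))); rewrite permKV nuE /= !permKV; case: x. Qed.

Section Shuffle.
Variables (n k l : nat) (q : factn n) (p : partn k (frow q)) (p' : partn l (fcol q)).

(** Distributing the product of the two sums gives one block of size [p i * p' j] for each pair
    [(i, j)]. *)
Lemma prod_partnE :
  \sum_(c < k * l) p (mcoord (fprod k l) c).1 * p' (mcoord (fprod k l) c).2 = n.
Proof.
rewrite -[RHS](factE q) -[in RHS](partE p) -[in RHS](partE p').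
rewrite big_distrl /=; under [RHS]eq_bigr do rewrite big_distrr /=.
rewrite pair_big (reindex (@mpos _ (fprod k l))) /=.
  by apply: eq_bigr => x _; rewrite mposK.
by exists (mcoord (fprod k l)) => x _; [apply: (mposK (q := fprod k l)) | apply: mcoordK].
Qed.

Definition prod_partn : partn (k * l) n := Partn prod_partnE.

(** This is [((i, j), (a, b))] sent to [((i, a), (j, b))], both read as positions in ['I_n]. *)
Definition shuffle_inv (e : 'I_n) : 'I_n :=
  let x := coord prod_partn e in
  let c := mcoord (fprod k l) (tag x) in
  let ab := mcoord (fprod (p c.1) (p' c.2)) (tagged x) in
  @mpos n q (pos (Tagged (fun i => 'I_(p i)) ab.1), pos (Tagged (fun j => 'I_(p' j)) ab.2)).

Lemma shuffle_inv_inj : injective shuffle_inv.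
Proof.
move=> e e' /(can_inj (@mposK _ q)) E; move: (congr1 fst E) (congr1 snd E) => /= {E} E1 E2.
apply: (can_inj (coordK prod_partn)).
case: (coord _ e) (coord _ e') E1 E2 => [c f] [c' f'].
move=> /(can_inj (@posK _ _ p)) /= E1 /(can_inj (@posK _ _ p')) /= E2.
(* The block indices are identified first, since the types of the positions inside the blocks depend
   on them. *)
have Ec : c = c'.
  apply: (can_inj (mcoordK (fprod k l))); move: (congr1 tag E1) (congr1 tag E2) => /=.
  by case: (mcoord _ c) (mcoord _ c') => [? ?] [? ?] /= -> ->.
subst c'; congr existT; apply: (can_inj (mcoordK (fprod _ _))).
have := eq_from_Tagged E1; have := eq_from_Tagged E2 => /=.
by case: (mcoord _ f) (mcoord _ f') => [? ?] [? ?] /= -> ->.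
Qed.

Definition shuffle : 'S_n := (perm shuffle_inv_inj)^-1%g.

Lemma shuffleV e : shuffle^-1%g e = shuffle_inv e.
Proof. by rewrite /shuffle invgK permE. Qed.

(** All later comparisons of labels go through this formula, so that [shuffle] need not be unfolded
    again. *)
Lemma lab_shuffle s t r c (e : 'I_(prod_partn c)) :
  lab (pcomp shuffle (pcomp (@nu n q (s, t)) r)) (Tagged (fun c => 'I_(prod_partn c)) e) =
  let ij := mcoord (fprod k l) c in
  let ab := mcoord (fprod (p ij.1) (p' ij.2)) e in
  r^-1%g (@mpos n q (lab s (Tagged (fun i => 'I_(p i)) ab.1),
                     lab t (Tagged (fun j => 'I_(p' j)) ab.2))).
Proof.
by rewrite lab_pcomp {1}/lab shuffleV /shuffle_inv posK /pcomp invMg permM nuV.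
Qed.

End Shuffle.

(** * Identities for [nu] and block sums, and products of simplices *)

Lemma mcoord_nuV n (q : factn n) s t c :
  mcoord q ((nu (s, t))^-1%g c) = (s^-1%g (mcoord q c).1, t^-1%g (mcoord q c).2).
Proof. by rewrite -{1}(mcoordK q c) nuV mposK. Qed.

Lemma permV1 n (i : 'I_n) : (1 : 'S_n)^-1%g i = i.
Proof. by rewrite invg1 perm1. Qed.

Lemma bsum1 k n (p : partn k n) : bsum (fun i => 1%g : 'S_(p i)) = 1%g.
Proof.
apply/permP => e; rewrite -(coordK p e) bsumE perm1.
by case: (coord p e) => i a /=; rewrite perm1.
Qed.

Lemma nuM n (q : factn n) s s' t t' :
  @nu n q (pcomp s t, pcomp s' t') = pcomp (nu (s, s')) (nu (t, t')).
Proof.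
by apply/permP => e; rewrite -(mcoordK q e) pcompE !nuE /= !pcompE.
Qed.

Lemma fam_act1 (Y : symSeq) k n (p : partn k n) d (y : forall i, Y (p i) d) :
  fam_act y (fun=> 1%g) = y.
Proof. by apply: functional_extensionality_dep => i; apply: ract1. Qed.

Definition sprod (X Y : symSeq) l m d (x : X l d) (y : Y m d) : (X \square Y) (l * m) d :=
  @square_mk X Y (l * m) d (fprod l m) x y 1%g.

Lemma sprod_ract (X Y : symSeq) l m d (x : X l d) (y : Y m d) s t :
  sprod (ract x s) (ract y t) = ract (sprod x y) (@nu _ (fprod l m) (s, t)).
Proof.
rewrite /sprod [LHS](@square_glue X Y _ _ (fprod l m)) [RHS]square_actE.
by rewrite /pcomp mulg1 mul1g.
Qed.

(** The [existT] form supplies the first hypothesis of [circ_mk_eq] and [circ_circ_eq], where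
    arities may be equal only propositionally. *)
Lemma sprod_eq (X Y : symSeq) l l' m m' d (x : X l d) (x' : X l' d) (y : Y m d) (y' : Y m' d) :
  existT (fun l => X l d) l x = existT _ l' x' ->
  existT (fun m => Y m d) m y = existT _ m' y' ->
  existT (fun n => (X \square Y) n d) (l * m) (sprod x y) = existT _ (l' * m') (sprod x' y').
Proof.
move=> Ex Ey; have El := congr1 (@projT1 _ _) Ex; have Em := congr1 (@projT1 _ _) Ey.
simpl in El, Em; subst l' m'.
have /= -> := @eq_from_Tagged nat (fun l => X l d) _ _ _ Ex.
by have /= -> := @eq_from_Tagged nat (fun m => Y m d) _ _ _ Ey.
Qed.

(** * Construction of [sigma] *)

Section Sigma.
Variables V W Y Z : symSeq.

Section Mk.
Variables (n d : nat) (q : factn n).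

Definition sigma_mk k l (v : V k d) (p : partn k (frow q)) (w : forall i, W (p i) d) s
    (y : Y l d) (p' : partn l (fcol q)) (z : forall j, Z (p' j) d) s' (r : 'S_n) :
    ((V \square Y) \circ (W \square Z)) n d :=
  @circ_mk (V \square Y) (W \square Z) n d (k * l) (sprod v y) (prod_partn p p')
    (fun c => sprod (w (mcoord (fprod k l) c).1) (z (mcoord (fprod k l) c).2))
    (pcomp (shuffle p p') (pcomp (@nu n q (s, s')) r)).

Lemma sigma_mk_bsum k l (v : V k d) (p : partn k (frow q)) (w : forall i, W (p i) d) t s
    (y : Y l d) (p' : partn l (fcol q)) (z : forall j, Z (p' j) d) t' s' (r : 'S_n) :
  sigma_mk v (fam_act w t) s y (fam_act z t') s' r =
  sigma_mk v w (pcomp (bsum t) s) y z (pcomp (bsum t') s') r.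
Proof.
rewrite /sigma_mk.
(* By [sprod_ract], acting by [t] and [t'] on the factors is acting by their [nu] on the product, so
   a single block sum absorbs both. *)
pose T c : 'S_(prod_partn p p' c) := @nu _ (fprod (p (mcoord (fprod k l) c).1)
  (p' (mcoord (fprod k l) c).2)) (t _, t' _).
transitivity (@circ_mk (V \square Y) (W \square Z) n d (k * l) (sprod v y) (prod_partn p p')
  (@fam_act (W \square Z) _ _ (prod_partn p p') d
    (fun c => sprod (w (mcoord (fprod k l) c).1) (z (mcoord (fprod k l) c).2)) T)
    (pcomp (shuffle p p') (pcomp (@nu n q (s, s')) r))).
  by congr circ_mk; apply: functional_extensionality_dep => c; apply: sprod_ract.
rewrite circ_glue_bsum; apply: circ_mk_eq => // c a a' /val_inj <-.
rewrite lab_pcomp lab_bsum /= -/(lab _ _) lab_shuffle [RHS]lab_shuffle /=.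
by rewrite !lab_pcomp !lab_bsum /= mcoord_nuV.
Qed.

(* [p0] and [p0'] are only pointwise equal to [partn_act t p] and [partn_act t' p'], so that
   taking [t = 1] or [t' = 1] gives the gluing in one variable at a time. *)
Lemma sigma_mk_block k l (v : V k d) (t : 'S_k) (p p0 : partn k (frow q))
    (w : forall i, W (p i) d) (w0 : forall i, W (p0 i) d) s s0
    (y : Y l d) (t' : 'S_l) (p' p0' : partn l (fcol q)) (z : forall j, Z (p' j) d)
    (z0 : forall j, Z (p0' j) d) s' s0' (r : 'S_n) :
  (forall i, existT (fun m => W m d) (p (t^-1%g i)) (w (t^-1%g i)) = existT _ (p0 i) (w0 i)) ->
  (forall i (a : 'I_(p (t^-1%g i))) (a' : 'I_(p0 i)), val a = val a' ->
    lab s (Tagged (fun i => 'I_(p i)) a) = lab s0 (Tagged (fun i => 'I_(p0 i)) a')) ->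
  (forall j, existT (fun m => Z m d) (p' (t'^-1%g j)) (z (t'^-1%g j)) = existT _ (p0' j) (z0 j)) ->
  (forall j (b : 'I_(p' (t'^-1%g j))) (b' : 'I_(p0' j)), val b = val b' ->
    lab s' (Tagged (fun j => 'I_(p' j)) b) = lab s0' (Tagged (fun j => 'I_(p0' j)) b')) ->
  sigma_mk (ract v t) w s (ract y t') z s' r = sigma_mk v w0 s0 y z0 s0' r.
Proof.
move=> wE sE zE s'E; rewrite /sigma_mk sprod_ract circ_glue_block.
apply: circ_mk_eq => [c|c a a' aE].
  by rewrite /= mcoord_nuV; exact: (sprod_eq (wE _) (zE _)).
rewrite lab_pcomp (@lab_block_perm _ _ (prod_partn p p')) -/(lab _ _).
rewrite lab_shuffle [RHS]lab_shuffle /=.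
(* The type of [a] depends on the coordinates of the permuted index, so these are generalized before
   being rewritten. *)
move: a aE; rewrite /=.
move: (mcoord _ (_ c)) (mcoord_nuV (q := fprod k l) t t' c) => m -> /= a aE.
have [E1 E2] := mcoord_eq (congr1 (@projT1 _ _) (zE _)) aE.
by rewrite (sE _ _ _ E1) (s'E _ _ _ E2).
Qed.

(** The descent to quotients is done one variable at a time. Here a representative of the first
    factor is fixed, and inserting identity actions on it makes the two-variable lemmas apply. *)
Lemma sigma_inv_r k (v : V k d) (p : partn k (frow q)) (w : forall i, W (p i) d) s r :
  @circ_inv Y Z (fcol q) d _ (fun l y p' z s' => sigma_mk v w s y z s' r).
Proof.
split=> [l y p' z t s'|l y t p' z s'].
  by rewrite -[in LHS](fam_act1 w) sigma_mk_bsum bsum1 /pcomp mulg1.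
rewrite -[in LHS](ract1 v); apply: sigma_mk_block => //.
- by move=> i; rewrite permV1.
- by move=> i; rewrite permV1 => a a' /val_inj ->.
by move=> *; apply: lab_block_pcomp.
Qed.

(** Since the second variable has already descended, its class may be arbitrary, and a
    representative of it is chosen to treat the first. *)
Lemma sigma_inv_l (u : (Y \circ Z) (fcol q) d) r :
  @circ_inv V W (frow q) d _ (fun k v p w s =>
    @circ_rec Y Z (fcol q) d _ (fun l y p' z s' => sigma_mk v w s y z s' r) u).
Proof.
elim/circ_ind: u => l y p' z s'.
split=> [k v p w t s|k v t p w s]; rewrite !(circ_recE (sigma_inv_r _ _ _ _)).
  by rewrite -[in LHS](fam_act1 z) sigma_mk_bsum bsum1 /pcomp mulg1.
rewrite -[in LHS](ract1 y); apply: sigma_mk_block => //.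
- by move=> *; apply: lab_block_pcomp.
- by move=> j; rewrite permV1.
by move=> j; rewrite permV1 => b b' /val_inj ->.
Qed.

End Mk.

Definition sigma_fun n d (u : ((V \circ W) \square (Y \circ Z)) n d) :
    ((V \square Y) \circ (W \square Z)) n d :=
  @square_rec (V \circ W) (Y \circ Z) n d _ (fun q u u' r =>
    @circ_rec V W (frow q) d _ (fun k v p w s =>
      @circ_rec Y Z (fcol q) d _ (fun l y p' z s' => sigma_mk v w s y z s' r) u') u) u.

Lemma sigmaE n d q k l (v : V k d) (p : partn k (frow q)) (w : forall i, W (p i) d) s
    (y : Y l d) (p' : partn l (fcol q)) (z : forall j, Z (p' j) d) s' (r : 'S_n) :
  sigma_fun (@square_mk (V \circ W) (Y \circ Z) n d q (circ_mk v w s) (circ_mk y z s') r) =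
  sigma_mk v w s y z s' r.
Proof.
rewrite /sigma_fun square_recE.
  by rewrite (circ_recE (sigma_inv_l _ _)) (circ_recE (sigma_inv_r _ _ _ _)).
(* What remains is the balancing relation of [\square]; it is respected because [nu] is
   multiplicative. *)
move=> {k l v p w s y p' z s' r} {}q u u' t t' r.
elim/circ_ind: u => k v p w s; elim/circ_ind: u' => l y p' z s'.
rewrite [ract _ t]circ_actE [ract _ t']circ_actE.
rewrite !(circ_recE (sigma_inv_l _ _)) !(circ_recE (sigma_inv_r _ _ _ _)).
by rewrite /sigma_mk nuM -pcompA.
Qed.

Lemma sigma_sop n d e (h : {omorphism 'I_d.+1 -> 'I_e.+1})
    (u : ((V \circ W) \square (Y \circ Z)) n e) :
  sigma_fun (sop h u) = sop h (sigma_fun u).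
Proof.
elim/square_ind: u => q u u' r.
elim/circ_ind: u => k v p w s; elim/circ_ind: u' => l y p' z s'.
rewrite sop_squareE !sop_circE !sigmaE /sigma_mk sop_circE /sprod sop_squareE.
by congr circ_mk; apply: functional_extensionality_dep => c; rewrite sop_squareE.
Qed.

Lemma sigma_act n d (u : ((V \circ W) \square (Y \circ Z)) n d) (t : 'S_n) :
  sigma_fun (ract u t) = ract (sigma_fun u) t.
Proof.
elim/square_ind: u => q u u' r.
elim/circ_ind: u => k v p w s; elim/circ_ind: u' => l y p' z s'.
by rewrite [ract _ t]square_actE !sigmaE /sigma_mk [RHS]circ_actE !pcompA.
Qed.

Definition sigma : symHom ((V \circ W) \square (Y \circ Z)) ((V \square Y) \circ (W \square Z)) :=
  SymHom sigma_sop sigma_act.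

End Sigma.

(** * Evaluation on representatives and naturality *)

Lemma circ_homE X X' Y Y' (f : symHom X X') (g : symHom Y Y') n d k x (p : partn k n) y r :
  circ_hom f g n d (@circ_mk X Y n d k x p y r) = circ_mk (f k d x) (fun i => g (p i) d (y i)) r.
Proof. by apply: circ_mapE => *; apply: hom_act. Qed.

Lemma square_homE X X' Y Y' (f : symHom X X') (g : symHom Y Y') n d (q : factn n) x y r :
  square_hom f g n d (@square_mk X Y n d q x y r) = square_mk (f _ d x) (g _ d y) r.
Proof. by apply: square_mapE => *; apply: hom_act. Qed.

Lemma hom_compE X Y Z (g : symHom Y Z) (f : symHom X Y) n d x :
  hom_comp g f n d x = g n d (f n d x).
Proof. by []. Qed.

Lemma sigma_homE (V W Y Z : symSeq) n d q k l (v : V k d) (p : partn k (frow q))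
    (w : forall i, W (p i) d) s (y : Y l d) (p' : partn l (fcol q))
    (z : forall j, Z (p' j) d) s' (r : 'S_n) :
  sigma V W Y Z n d
    (@square_mk (V \circ W) (Y \circ Z) n d q (circ_mk v w s) (circ_mk y z s') r) =
  sigma_mk v w s y z s' r.
Proof. exact: sigmaE. Qed.

Lemma assoc_homE (X Y Z : symSeq) k l n d (x : X l d) (p : partn l k) (y : forall i, Y (p i) d) s
    (q : partn k n) (z : forall c, Z (q c) d) (r : 'S_n) :
  assoc X Y Z n d (@circ_mk (X \circ Y) Z n d k (circ_mk x y s) q z r) =
  assoc_mk x y z r (@assoc_idx_inj k l p s) (o := assoc_out p s q) (fun=> erefl).
Proof. exact: assocE. Qed.

(** On representatives, both sides apply the four maps to the operations and keep the labels. *)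
Lemma sigma_natural (V V' W W' Y Y' Z Z' : symSeq)
    (f : symHom V V') (g : symHom W W') (h : symHom Y Y') (k : symHom Z Z') :
  eq_hom
    (hom_comp (sigma V' W' Y' Z') (square_hom (circ_hom f g) (circ_hom h k)))
    (hom_comp (circ_hom (square_hom f h) (square_hom g k)) (sigma V W Y Z)).
Proof.
move=> n d u; elim/square_ind: u => q u u' r.
elim/circ_ind: u => l v p w s; elim/circ_ind: u' => m y p' z s'.
rewrite !hom_compE square_homE !circ_homE !sigma_homE /sigma_mk circ_homE /sprod square_homE.
by congr circ_mk; apply: functional_extensionality_dep => c; rewrite square_homE.
Qed.

(** * Compatibility with the associativity of the composition product *)

Lemma circ_mk_ext (X Y : symSeq) n d k (x : X k d) (p : partn k n)
    (y y' : forall i, Y (p i) d) (r : 'S_n) :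
  (forall i, y i = y' i) -> circ_mk x y r = circ_mk x y' r.
Proof. by move=> yE; congr circ_mk; apply: functional_extensionality_dep. Qed.

(** Regrouping moves inputs without changing their labels. *)
Lemma lab_assoc k l n (p : partn l k) (q : partn k n) (o : partn l n)
    (a : {i : 'I_l & 'I_(p i)} -> 'I_k) a_inj oE r i j (b : 'I_(@assoc_in k l n p q o a oE i j)) :
  lab (pcomp (assoc_perm a_inj oE) r)
    (Tagged (fun i => 'I_(o i)) (pos (Tagged (fun j => 'I_(assoc_in oE i j)) b))) =
  lab r (Tagged (fun c => 'I_(q c)) (b : 'I_(q (a (Tagged (fun i => 'I_(p i)) j))))).
Proof. by rewrite lab_pcomp {1}/lab assoc_permV. Qed.

(** The isomorphisms [assoc], suppressed in the informal statement, appear explicitly. On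
    representatives the outer and middle operations of both sides agree by computation;
    [circ_circ_eq] leaves the innermost operations and labels to compare. *)
Lemma sigma_assoc (U V W X Y Z : symSeq) :
  eq_hom
    (hom_comp
      (hom_comp (circ_hom (hom_id (U \square X)) (sigma V W Y Z))
                (sigma U (V \circ W) X (Y \circ Z)))
      (square_hom (assoc U V W) (assoc X Y Z)))
    (hom_comp
      (assoc (U \square X) (V \square Y) (W \square Z))
      (hom_comp (circ_hom (sigma U V X Y) (hom_id (W \square Z)))
                (sigma (U \circ V) W (X \circ Y) Z))).
Proof.
move=> n d u; elim/square_ind: u => q u u' r.
elim/circ_ind: u => k u c w s; elim/circ_ind: u => l u p v t.
elim/circ_ind: u' => k' x c' z s'; elim/circ_ind: x => l' x p' y t'.
rewrite !hom_compE square_homE !assoc_homE !sigma_homE circ_homE.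
rewrite [in RHS]circ_homE sigma_homE.
rewrite assoc_homE /assoc_mk.
etransitivity; first by apply: circ_mk_ext => i; apply: sigma_homE.
pose pp : partn (l * l') (k * k') := @prod_partn _ l l' (fprod k k') p p'.
(* [assoc_idx] is itself a label, so [lab_shuffle] computes the regrouped middle index as the pair
   of those found in the two factors. *)
have idxE i (j : 'I_(pp i)) : assoc_idx (pcomp (@shuffle _ l l' (fprod k k') p p')
    (pcomp (@nu _ (fprod k k') (t, t')) 1%g))
    (Tagged (fun i => 'I_(pp i)) j) = @mpos _ (fprod k k')
      (assoc_idx t (Tagged (fun i => 'I_(p i)) (mcoord (fprod _ _) j).1),
       assoc_idx t' (Tagged (fun i => 'I_(p' i)) (mcoord (fprod _ _) j).2)) :> 'I_(k * k').
  by rewrite [LHS]lab_shuffle /= permV1.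
apply: circ_circ_eq => i j.
  rewrite /= idxE mposK; exact: sprod_eq.
move=> a a' aE.
(* Both labels reduce to the preimage under [r] of a pair of labels in the two factors: on the left
   through the outer [sigma], the inner [sigma] and two [assoc], on the right through one [assoc]
   and one [sigma]. *)
rewrite [LHS]lab_shuffle /= [lab (pcomp (shuffle _ _) (pcomp _ 1%g)) _]lab_shuffle /=.
rewrite permV1 !lab1 mposK /=.
rewrite (@lab_assoc _ _ _ p c (assoc_out p t c)).
rewrite (@lab_assoc _ _ _ p' c' (assoc_out p' t' c')).
rewrite lab_assoc lab_shuffle /=.
(* The type of [a'] depends on the middle index, which is therefore generalized before [idxE]
   replaces it. *)
move: a' aE; rewrite /=; move: (assoc_idx (pcomp _ _) _) (idxE i j) => C ->.
by rewrite mposK /= => a' /val_inj ->.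
Qed.

Theorem proposition1p20 :
  exists sigma : forall V W Y Z : symSeq,
      symHom ((V \circ W) \square (Y \circ Z)) ((V \square Y) \circ (W \square Z)),
    (forall (V V' W W' Y Y' Z Z' : symSeq)
        (f : symHom V V') (g : symHom W W') (h : symHom Y Y') (k : symHom Z Z'),
      eq_hom
        (hom_comp (sigma V' W' Y' Z') (square_hom (circ_hom f g) (circ_hom h k)))
        (hom_comp (circ_hom (square_hom f h) (square_hom g k)) (sigma V W Y Z)))
    /\
    (forall U V W X Y Z : symSeq,
      eq_hom
        (hom_comp
          (hom_comp (circ_hom (hom_id (U \square X)) (sigma V W Y Z))
                    (sigma U (V \circ W) X (Y \circ Z)))
          (square_hom (assoc U V W) (assoc X Y Z)))
        (hom_comp
          (assoc (U \square X) (V \square Y) (W \square Z))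
          (hom_comp (circ_hom (sigma U V X Y) (hom_id (W \square Z)))
                    (sigma (U \circ V) W (X \circ Y) Z)))).
Proof. by exists sigma; split; [apply: sigma_natural | apply: sigma_assoc]. Qed.
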